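(* Let $\mathcal{R}$ be a collection of axis-parallel rectangles and $P$ a set of points such that the piercing graph of $\mathcal{R}$ has chromatic number $k$. Then there is a collection of $k$ planar graphs on $P$ whose union is a support for the hypergraph $(P,\mathcal{R})$, i.e., for every $R\in\mathcal{R}$ the union graph induced on $R\cap P$ is connected.
   Context: The piercing graph of $\mathcal{R}$ has vertex set $\mathcal{R}$ and an edge between two rectangles iff they intersect but neither contains a corner of the other. The hypergraph $(P,\mathcal{R})$ has vertex set $P$ and, for each $R\in\mathcal{R}$, the hyperedge $R\cap P$. Points and rectangles are assumed in general position (distinct coordinates, no point on a rectangle boundary). *)

(* Defs.v *)
From HB Require Import structures.
From mathcomp Require Import all_boot all_order all_algebra.
From mathcomp Require Import all_classical all_reals all_analysis.
Set Implicit Arguments. Unset Strict Implicit. Unset Printing Implicit Defensive.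
Import Order.TTheory GRing.Theory Num.Theory.
Import numFieldNormedType.Exports.
Local Open Scope ring_scope.

Record rect (R : realType) := Rect { rx1 : R; rx2 : R; ry1 : R; ry2 : R }.

Definition wf_rect (R : realType) (r : rect R) : Prop :=
  rx1 r < rx2 r /\ ry1 r < ry2 r.

Definition in_rect (R : realType) (r : rect R) (p : R * R) : bool :=
  (rx1 r <= p.1 <= rx2 r) && (ry1 r <= p.2 <= ry2 r).

Definition corners (R : realType) (r : rect R) : seq (R * R) :=
  [:: (rx1 r, ry1 r); (rx1 r, ry2 r); (rx2 r, ry1 r); (rx2 r, ry2 r)].

Definition rects_intersect (R : realType) (r s : rect R) : bool :=
  [&& rx1 r <= rx2 s, rx1 s <= rx2 r, ry1 r <= ry2 s & ry1 s <= ry2 r].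

Definition contains_corner_of (R : realType) (r s : rect R) : bool :=
  has (in_rect r) (corners s).

Definition piercing_edge (R : realType) (I : finType) (rs : I -> rect R) : rel I :=
  fun i j => [&& i != j, rects_intersect (rs i) (rs j),
                 ~~ contains_corner_of (rs i) (rs j)
               & ~~ contains_corner_of (rs j) (rs i)].

Definition proper_coloring (V : finType) (e : rel V) (k : nat) (c : V -> 'I_k) : Prop :=
  forall u v, e u v -> c u != c v.

Definition colorable (V : finType) (e : rel V) (k : nat) : Prop :=
  exists c : V -> 'I_k, proper_coloring e c.

Definition chromatic_number (V : finType) (e : rel V) (k : nat) : Prop :=
  colorable e k /\ forall m, (m < k)%N -> ~ colorable e m.

Definition general_position (R : realType) (I J : finType)
    (rs : I -> rect R) (ps : J -> R * R) : Prop :=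
  (forall p q : J, p != q -> (ps p).1 != (ps q).1 /\ (ps p).2 != (ps q).2) /\
  (forall (p : J) (i : I),
      [/\ (ps p).1 != rx1 (rs i), (ps p).1 != rx2 (rs i),
          (ps p).2 != ry1 (rs i) & (ps p).2 != ry2 (rs i)]) /\
  (forall i j : I, i != j ->
      [/\ rx1 (rs i) \notin [:: rx1 (rs j); rx2 (rs j)],
          rx2 (rs i) \notin [:: rx1 (rs j); rx2 (rs j)],
          ry1 (rs i) \notin [:: ry1 (rs j); ry2 (rs j)] &
          ry2 (rs i) \notin [:: ry1 (rs j); ry2 (rs j)]]).

(** Planarity (topological definition): the graph with edges
    {u,v}, u != v, e u v admits a drawing in R^2: vertices are mapped to
    distinct points, each edge to a simple arc (continuous injective image of
    [0,1]) joining its endpoints, whose interior avoids all vertices and is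
    disjoint from the interior of every arc of a different edge. An arc is
    given by its two coordinate functions. *)
Definition planar (R : realType) (V : finType) (e : rel V) : Prop :=
  exists (pos : V -> R * R) (ax ay : V -> V -> R -> R),
    injective pos /\
    (forall u v, u != v -> e u v ->
       [/\ {within `[0, 1], continuous (ax u v)}%classic,
           {within `[0, 1], continuous (ay u v)}%classic,
           (ax u v 0, ay u v 0) = pos u,
           (ax u v 1, ay u v 1) = pos v &
           {in `[0, 1]%classic &, injective (fun t => (ax u v t, ay u v t))}]) /\
    (forall u v w t, u != v -> e u v -> 0 < t < 1 ->
       (ax u v t, ay u v t) <> pos w) /\
    (forall u v u' v' s t, u != v -> e u v -> u' != v' -> e u' v' ->
       ~ ((u == u') && (v == v') || (u == v') && (v == u')) ->
       0 < s < 1 -> 0 < t < 1 ->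
       (ax u v s, ay u v s) <> (ax u' v' t, ay u' v' t)).

Definition union_graph (V : finType) (k : nat) (G : 'I_k -> rel V) : rel V :=
  fun u v => [exists i, G i u v].

(** The graph e induced on the vertex subset S is connected
    (vacuous when S is empty). *)
Definition induced_connected (V : finType) (e : rel V) (S : pred V) : Prop :=
  forall u v, S u -> S v ->
    connect (fun a b => [&& S a, S b & e a b]) u v.

Definition is_support (R : realType) (I J : finType)
    (rs : I -> rect R) (ps : J -> R * R) (e : rel J) : Prop :=
  forall i : I, induced_connected e (fun p => in_rect (rs i) (ps p)).

(* Main.v *)
(** Replace each rectangle of one color by the set of points it contains; no
    two of these sets "pierce" each other, i.e. no bounding box is strictly
    wider than another one which is in turn strictly taller. Take a maximal
    family of box-closed point sets without piercing pairs. If removing an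
    x-extreme point of a member [S] leaves the family, maximality provides a
    member stretching across [S] horizontally; dually for y-extreme points. A
    horizontal and a vertical one would pierce each other, so [S] can lose
    either of its two x-extreme points, or either of its two y-extreme points,
    within the family. By induction on the size, the two-point members connect
    every member; drawn as straight segments they do not cross, since crossing
    segments with empty boxes have piercing boxes. *)
Require Import Defs.
From HB Require Import structures.
From mathcomp Require Import all_boot all_order all_algebra.
From mathcomp Require Import all_classical all_reals all_analysis.
From mathcomp Require Import ring lra.
Set Implicit Arguments. Unset Strict Implicit. Unset Printing Implicit Defensive.
Import Order.TTheory GRing.Theory Num.Theory.
Import numFieldNormedType.Exports.
Local Open Scope ring_scope.

(** * Box-closed point sets and piercing *)

Section Boxes.
Variables (R : realFieldType) (J : finType).
Implicit Types (x y : J -> R) (S T : {set J}) (F : {set {set J}}).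

(** [S] is the trace of its bounding box. Witnesses replace minima and maxima, so the empty set
    needs no special case. *)
Definition box_closed x y S : Prop := forall w,
  (exists2 l, l \in S & x l <= x w) -> (exists2 r, r \in S & x w <= x r) ->
  (exists2 b, b \in S & y b <= y w) -> (exists2 t, t \in S & y w <= y t) ->
  w \in S.

(* The bounding box of [S] crosses that of [T] from left to right. *)
Definition pierces x y S T : Prop :=
  [/\ exists2 l, l \in S & forall w, w \in T -> x l < x w,
      exists2 r, r \in S & forall w, w \in T -> x w < x r,
      exists2 b, b \in T & forall w, w \in S -> y b < y w &
      exists2 t, t \in T & forall w, w \in S -> y w < y t].

(** [pierces] with the strictness in [x] dropped: this is what survives when a point is put back
    into [T]. *)
Definition spans x y S T : Prop :=
  [/\ forall w, w \in T -> exists2 l, l \in S & x l <= x w,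
      forall w, w \in T -> exists2 r, r \in S & x w <= x r,
      exists2 b, b \in T & forall w, w \in S -> y b < y w &
      exists2 t, t \in T & forall w, w \in S -> y w < y t].

Definition nonpiercing_family x y F : Prop :=
  (forall S, S \in F -> box_closed x y S) /\
  (forall S T, S \in F -> T \in F -> ~ pierces x y S T).

Definition maximal_nonpiercing x y F : Prop :=
  nonpiercing_family x y F /\
  forall S, nonpiercing_family x y (S |: F) -> S \in F.

Definition extreme x S v : Prop :=
  (forall w, w \in S -> x v <= x w) \/ (forall w, w \in S -> x w <= x v).

Lemma box_closedC x y S : box_closed x y S -> box_closed y x S.
Proof. by move=> h w ? ? ? ?; apply: h. Qed.

Lemma piercesC x y S T : pierces x y S T -> pierces y x T S.
Proof. by case=> ? ? ? ?; split. Qed.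

Lemma nonpiercing_familyC x y F :
  nonpiercing_family x y F -> nonpiercing_family y x F.
Proof.
move=> [cl np]; split=> [S SF|S T SF TF /piercesC]; last exact: np.
exact/box_closedC/cl.
Qed.

Lemma maximal_nonpiercingC x y F :
  maximal_nonpiercing x y F -> maximal_nonpiercing y x F.
Proof.
by move=> [/nonpiercing_familyC h mx]; split=> // S /nonpiercing_familyC/mx.
Qed.

Lemma pierces_irrefl x y S : ~ pierces x y S S.
Proof. by case=> [[l lS h]] _ _ _; have := h _ lS; rewrite ltxx. Qed.

(** * Deleting extreme points in a maximal family *)

(** Each comparison passes through [S], which one of the two sets bounds weakly and the other
    strictly. *)
Lemma spans_pierces x y S T T' :
  spans x y T S -> spans y x T' S -> pierces x y T T'.
Proof.
move=> [tl tr [b bS tb] [t tS tt]] [tb' tt' [l lS tl'] [r rS tr']]; split.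
- have [l0 l0T h] := tl _ lS; exists l0 => // w wT'.
  exact: le_lt_trans h (tl' _ wT').
- have [r0 r0T h] := tr _ rS; exists r0 => // w wT'.
  exact: lt_le_trans (tr' _ wT') h.
- have [b0 b0T h] := tb' _ bS; exists b0 => // w wT.
  exact: le_lt_trans h (tb _ wT).
- have [t0 t0T h] := tt' _ tS; exists t0 => // w wT.
  exact: lt_le_trans (tt _ wT) h.
Qed.

(** Only [v] could stick out of [T] sideways. Then the witness [l] or [r] of [T] would lie in the
    box of [S], hence in [S :\ v], although it is strictly beyond all of that set. *)
Lemma pierces_del_spans x y S T v : box_closed x y S -> v \in S ->
  pierces x y T (S :\ v) -> spans x y T S.
Proof.
move=> cl vS [[l lT hl] [r rT hr] [b bS hb] [t tS ht]].
have sub w : w \in S :\ v -> w \in S by rewrite !inE => /andP[].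
have inS w : w \in S -> w != v -> w \in S :\ v by rewrite !inE => -> ->.
have yT w : w \in T -> (exists2 b, b \in S & y b <= y w) /\
                       (exists2 t, t \in S & y w <= y t).
  move=> wT; split; first by exists b; [exact: sub|exact/ltW/hb].
  by exists t; [exact: sub|exact/ltW/ht].
split.
- move=> w wS; have [->|wv] := eqVneq w v; last first.
    by exists l => //; apply/ltW/hl/inS.
  exists l => //; rewrite leNgt; apply/negP => vl.
  have lS : l \in S.
    have [? ?] := yT _ lT.
    apply: cl => //; first by exists v => //; exact: ltW.
    (* [b] serves only as some point of [S :\ v], all of which lie to the right of [l]. *)
    by exists b; [exact: sub|exact/ltW/hl].
  have lv : l != v by apply: contraTneq vl => ->; rewrite ltxx.
  by have := hl _ (inS _ lS lv); rewrite ltxx.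
- move=> w wS; have [->|wv] := eqVneq w v; last first.
    by exists r => //; apply/ltW/hr/inS.
  exists r => //; rewrite leNgt; apply/negP => vr.
  have rS : r \in S.
    have [? ?] := yT _ rT.
    apply: cl => //; last by exists v => //; exact: ltW.
    by exists b; [exact: sub|exact/ltW/hr].
  have rv : r != v by apply: contraTneq vr => ->; rewrite ltxx.
  by have := hr _ (inS _ rS rv); rewrite ltxx.
- by exists b => //; exact: sub.
- by exists t => //; exact: sub.
Qed.

(** Putting [v] back could only break a vertical bound, say with [v] not above [b]. Then [b] lies in
    the box of [S], so in [S]; being below all of [S :\ v], it must be [v]. But a point of [T] has
    points of [S :\ v] strictly on both sides, contrary to extremality. *)
Lemma not_del_extreme_pierces x y S T v : box_closed x y S -> v \in S ->
  extreme x S v -> ~ pierces x y S T -> ~ pierces x y (S :\ v) T.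
Proof.
move=> cl vS ext np [[l lS hl] [r rS hr] [b bT hb] [t tT ht]].
have sub w : w \in S :\ v -> w \in S by rewrite !inE => /andP[].
have inS w : w \in S -> w != v -> w \in S :\ v by rewrite !inE => -> ->.
have vnT : v \in T -> False.
  move=> vT; case: ext => [/(_ _ (sub _ lS))|/(_ _ (sub _ rS))].
    by rewrite leNgt hl.
  by rewrite leNgt hr.
have xT w : w \in T -> (exists2 l, l \in S & x l <= x w) /\
                       (exists2 r, r \in S & x w <= x r).
  move=> wT; split; first by exists l; [exact: sub|exact/ltW/hl].
  by exists r; [exact: sub|exact/ltW/hr].
apply: np; split.
- by exists l => //; exact: sub.
- by exists r => //; exact: sub.
- exists b => // w wS; have [->|wv] := eqVneq w v; last exact/hb/inS.
  rewrite ltNge; apply/negP => vb; apply: vnT.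
  have bS : b \in S.
    have [? ?] := xT _ bT.
    apply: cl => //; first by exists v.
    by exists l; [exact: sub|exact/ltW/hb].
  have [<- //|bv] := eqVneq b v.
  by have := hb _ (inS _ bS bv); rewrite ltxx.
- exists t => // w wS; have [->|wv] := eqVneq w v; last exact/ht/inS.
  rewrite ltNge; apply/negP => vt; apply: vnT.
  have tS : t \in S.
    have [? ?] := xT _ tT.
    apply: cl => //; last by exists v.
    by exists l; [exact: sub|exact/ltW/ht].
  have [<- //|tv] := eqVneq t v.
  by have := ht _ (inS _ tS tv); rewrite ltxx.
Qed.

(** If [v] were in the box of the remaining points, extremality would give one of them the same
    [x]. *)
Lemma box_closed_del_extreme x y S v : injective x -> box_closed x y S ->
  extreme x S v -> box_closed x y (S :\ v).
Proof.
move=> xI cl ext w [l lS hl] [r rS hr] [b bS hb] [t tS ht].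
have sub u : u \in S :\ v -> u \in S by rewrite !inE => /andP[].
rewrite in_setD1; apply/andP; split; last first.
  by apply: cl; [exists l|exists r|exists b|exists t] => //; exact: sub.
apply/eqP => wv; rewrite wv in hl hr.
case: ext => ext.
- have e : l = v by apply/xI/le_anti; rewrite hl (ext _ (sub _ lS)).
  by rewrite e !inE eqxx in lS.
- have e : r = v by apply/xI/le_anti; rewrite hr (ext _ (sub _ rS)).
  by rewrite e !inE eqxx in rS.
Qed.

(** By maximality, adding a missing [S :\ v] creates a piercing pair. Since [S :\ v] cannot pierce,
    it is pierced by some [T], which then spans [S]. *)
Lemma maximal_del_extreme x y F S v : injective x ->
  maximal_nonpiercing x y F -> S \in F -> v \in S -> extreme x S v ->
  S :\ v \in F \/ exists2 T, T \in F & spans x y T S.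
Proof.
move=> xI [[cl np] mx] SF vS ext.
have [|nF] := boolP (S :\ v \in F); [by left|right].
apply: contrapT => nspan; case/negP: nF; apply: mx; split.
- move=> T /setU1P[->|/cl//].
  by apply: box_closed_del_extreme => //; exact: cl.
- move=> T T' /setU1P[->|TF] /setU1P[->|T'F].
  + exact: pierces_irrefl.
  + by apply: not_del_extreme_pierces => //; [exact: cl|exact: np].
  + move=> /(pierces_del_spans (cl _ SF) vS) sp; apply: nspan.
    by exists T.
  + exact: np.
Qed.

Lemma two_extremes x S : injective x -> (1 < #|S|)%N ->
  exists v w, [/\ v \in S, w \in S, v != w, extreme x S v & extreme x S w].
Proof.
move=> xI S1.
have /card_gt0P[z zS] : (0 < #|S|)%N by exact: ltnW.
case: (@arg_minP _ _ _ z (mem S) x zS) => v vS hv.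
have {}vS : v \in S := vS.
have /card_gt0P[z' z'S] : (0 < #|S :\ v|)%N.
  by move: S1; rewrite (cardsD1 v S) vS.
move: z'S; rewrite !inE => /andP[z'v z'S].
case: (@arg_maxP _ _ _ z (mem S) x zS) => w wS hw.
exists v, w; split => //; [|by left=> u uS; exact: hv|by right=> u uS; exact: hw].
(* If the minimum and the maximum were the same point, [z'] would coincide with it. *)
apply: contraNneq z'v => vw; apply/eqP/xI/le_anti.
by rewrite (hv _ z'S) andbT vw; exact: hw.
Qed.

Lemma maximal_two_deletions x y F S : injective x -> injective y ->
  maximal_nonpiercing x y F -> S \in F -> (1 < #|S|)%N ->
  exists v w, [/\ v \in S, w \in S, v != w, S :\ v \in F & S :\ w \in F].
Proof.
move=> xI yI mx SF S1.
have [v [w [vS wS vw ev ew]]] := two_extremes xI S1.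
have [v' [w' [v'S w'S vw' ev' ew']]] := two_extremes yI S1.
have mx' := maximal_nonpiercingC mx.
have np T T' : T \in F -> T' \in F -> spans x y T S -> spans y x T' S -> False.
  by move=> TF T'F sT sT'; apply: (mx.1.2 _ _ TF T'F (spans_pierces sT sT')).
(* One horizontally spanning member excludes every vertically spanning one, so both y-extreme points
   can be deleted. *)
have dy T : T \in F -> spans x y T S ->
    exists v w, [/\ v \in S, w \in S, v != w, S :\ v \in F & S :\ w \in F].
  move=> TF sT; exists v', w'; split=> //.
    by case: (maximal_del_extreme yI mx' SF v'S ev') => // -[T' /(np T) h] /h [].
  by case: (maximal_del_extreme yI mx' SF w'S ew') => // -[T' /(np T) h] /h [].
case: (maximal_del_extreme xI mx SF vS ev) => [hv|[T TF /(dy _ TF)//]].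
case: (maximal_del_extreme xI mx SF wS ew) => [hw|[T TF /(dy _ TF)//]].
by exists v, w.
Qed.

(** * Connectivity through two-point members, and existence of maximal families *)

Definition pair_graph F : rel J := fun p q => (p != q) && ([set p; q] \in F).

(** A two-point member is itself an edge. A larger one is the union of the smaller members [S :\ v1]
    and [S :\ v2]; they share a third point [z], through which all paths can be routed. *)
Lemma pair_graph_connected x y F S : injective x -> injective y ->
  maximal_nonpiercing x y F -> S \in F ->
  induced_connected (pair_graph F) (fun p => p \in S).
Proof.
move=> xI yI mx; have [n] := ubnP #|S|.
elim: n S => // n IH S Sn SF u v uS vS.
have [->|uv] := eqVneq u v; first exact: connect0.
have uvS : [set u; v] \subset S by apply/fintype.subsetP => w /set2P[]->.
have [S2|S2] := leqP #|S| 2.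
  have e : [set u; v] = S by apply/eqP; rewrite eqEcard uvS cards2 uv.
  by apply: connect1; rewrite /pair_graph uS vS uv e.
have [v1 [v2 [v1S v2S v12 F1 F2]]] := maximal_two_deletions xI yI mx SF (ltnW S2).
have /card_gt0P[z] : (0 < #|S :\ v1 :\ v2|)%N.
  move: S2; rewrite (cardsD1 v1 S) v1S (cardsD1 v2 (S :\ v1)).
  by rewrite !inE eq_sym v12 v2S.
rewrite !inE => /and3P[zv2 zv1 zS].
have sub a : a \in S -> a != v1 \/ a != v2.
  by move=> aS; have [->|] := eqVneq a v1; [right|left].
have mono a b v0 : v0 \in S -> S :\ v0 \in F -> a != v0 -> a \in S ->
    b != v0 -> b \in S ->
    connect (fun p q => [&& p \in S, q \in S & pair_graph F p q]) a b.
  move=> v0S F0 av0 aS bv0 bS.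
  have : connect (fun p q => [&& p \in S :\ v0, q \in S :\ v0 & pair_graph F p q])
      a b.
    apply: IH => //; rewrite ?inE ?av0 ?bv0 //.
    by move: Sn; rewrite (cardsD1 v0 S) v0S.
  apply: connect_sub => p q /and3P[pS qS e]; apply: connect1.
  by move: pS qS; rewrite !inE => /andP[_ ->] /andP[_ ->].
apply: (@connect_trans _ _ z).
  by have [h|h] := sub _ uS; [exact: (mono _ _ v1)|exact: (mono _ _ v2)].
by have [h|h] := sub _ vS; [exact: (mono _ _ v1)|exact: (mono _ _ v2)].
Qed.

Lemma maximal_nonpiercing_exists x y F0 : nonpiercing_family x y F0 ->
  exists2 F, maximal_nonpiercing x y F & F0 \subset F.
Proof.
move=> h0.
have [|F mF sF] := @maxset_exists _ (fun F => `[< nonpiercing_family x y F >]) F0.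
  exact/asboolP.
exists F => //; split.
  by move/maxsetp: mF => /asboolP.
move=> S hS; rewrite -(maxsetsup mF _ (finset.subsetUr [set S] F)) ?setU11 //.
exact/asboolP.
Qed.


(** * Crossing segments with empty boxes *)

(* The segments from [(-a, -c)] to [(b, d)] and from [(-a', -c')] to [(b', d')]
   pass through the origin, and neither box contains an endpoint of the other
   segment, except for common endpoints. *)
Lemma ascending_segments (a b c d a' b' c' d' : R) :
  0 < a -> 0 < b -> 0 < c -> 0 < d -> 0 < a' -> 0 < b' -> 0 < c' -> 0 < d' ->
  a * d = b * c -> a' * d' = b' * c' ->
  (a <= a' -> c <= c' -> a = a' /\ c = c') ->
  (a' <= a -> c' <= c -> a = a' /\ c = c') ->
  (b <= b' -> d <= d' -> b = b' /\ d = d') ->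
  (b' <= b -> d' <= d -> b = b' /\ d = d') ->
  [\/ [/\ a = a', b = b', c = c' & d = d'],
      [/\ a < a', b < b', c' < c & d' < d] |
      [/\ a' < a, b' < b, c < c' & d < d']].
Proof.
move=> a0 b0 c0 d0 a'0 b'0 c'0 d'0 ad ad' h1 h2 h3 h4.
(* Slopes without denominators: [g' / e' < g / e] at one end becomes [h' / f' < h / f] at the
   other. *)
have steeper (e f g h e' f' g' h' : R) : 0 < e -> 0 < f -> 0 < g -> 0 < h ->
    0 < e' -> 0 < f' -> 0 < g' -> 0 < h' -> e * h = f * g -> e' * h' = f' * g' ->
    e <= e' -> g' < g -> h' * f < h * f'.
  move=> e0 f0 g0 h0 e'0 f'0 g'0 h'0 E E' ee gg.
  rewrite -(ltr_pM2l (mulr_gt0 e0 e'0)).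
  have -> : e * e' * (h' * f) = e * f * (e' * h') by ring.
  have -> : e * e' * (h * f') = e' * f' * (e * h) by ring.
  rewrite E E'.
  have -> : e * f * (f' * g') = (f * f') * (e * g') by ring.
  have -> : e' * f' * (f * g) = (f * f') * (e' * g) by ring.
  rewrite ltr_pM2l ?mulr_gt0 //.
  apply: (@le_lt_trans _ _ (e' * g')); first by rewrite ler_pM2r.
  by rewrite ltr_pM2l.
(* Compare the lower left endpoints. If they agree, the slopes agree and so do the upper right ones;
   otherwise one segment is flatter, and this orders the other ends. *)
have [aa|aa] := leP a a'; have [cc|cc] := leP c c'.
- have [ea ec] := h1 aa cc; constructor 1; subst a' c'.
  have [bb|bb] := leP b b'.
    have dd : d <= d' by rewrite -(ler_pM2l a0) ad ad' ler_pM2r.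
    by have [-> ->] := h3 bb dd.
  have dd : d' <= d by rewrite -(ler_pM2l a0) ad ad' ler_pM2r // ltW.
  by have [-> ->] := h4 (ltW bb) dd.
- constructor 2.
  have st := steeper _ _ _ _ _ _ _ _ a0 b0 c0 d0 a'0 b'0 c'0 d'0 ad ad' aa cc.
  have {}aa : a < a'.
    rewrite lt_neqAle aa andbT; apply/eqP => ea.
    have [_ ec] : a = a' /\ c = c' by apply: h2; [rewrite ea|exact: ltW].
    by rewrite ec ltxx in cc.
  have bb : b < b'.
    rewrite ltNge; apply/negP => bb.
    have dd : d' < d.
      rewrite -(ltr_pM2r b0); apply: lt_le_trans st _.
      by rewrite ler_pM2l.
    by have [_ ed] := h4 bb (ltW dd); rewrite ed ltxx in dd.
  split=> //; rewrite ltNge; apply/negP => dd.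
  by have [eb _] := h3 (ltW bb) dd; rewrite eb ltxx in bb.
- constructor 3.
  have st := steeper _ _ _ _ _ _ _ _ a'0 b'0 c'0 d'0 a0 b0 c0 d0 ad' ad (ltW aa).
  have {}cc : c < c'.
    rewrite lt_neqAle cc andbT; apply/eqP => ec.
    have [ea _] : a = a' /\ c = c' by apply: h2; [exact: ltW|rewrite ec].
    by rewrite ea ltxx in aa.
  have {}st := st cc.
  have bb : b' < b.
    rewrite ltNge; apply/negP => bb.
    have dd : d < d'.
      rewrite -(ltr_pM2r b'0); apply: lt_le_trans st _.
      by rewrite ler_pM2l.
    by have [_ ed] := h3 bb (ltW dd); rewrite ed ltxx in dd.
  split=> //; rewrite ltNge; apply/negP => dd.
  by have [eb _] := h4 (ltW bb) dd; rewrite eb ltxx in bb.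
- by have [ea _] := h2 (ltW aa) (ltW cc); rewrite ea ltxx in aa.
Qed.

(* As above for [(-a, -c)], [(b, d)] and [(-a', d')], [(b', -c')]. *)
Lemma opposite_segments (a b c d a' b' c' d' : R) :
  ~ (a <= a' /\ c <= c') -> ~ (b <= b' /\ d <= d') ->
  ~ (a' <= a /\ d' <= d) -> ~ (b' <= b /\ c' <= c) ->
  [/\ a < a', b < b', c' < c & d' < d] \/ [/\ a' < a, b' < b, c < c' & d < d'].
Proof.
move=> h1 h2 h3 h4.
(* Two of the sixteen sign patterns survive; in these, a tie would fall under an excluded one. *)
have [aa|aa] := leP a a'; have [cc|cc] := leP c c';
  have [bb|bb] := leP b b'; have [dd|dd] := leP d d'; 
  try by [case: h1; split; lra|case: h2; split; lra|
          case: h3; split; lra|case: h4; split; lra].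
- left; split=> //; rewrite lt_neqAle ?aa ?bb andbT; apply/eqP => e.
    by apply: h3; rewrite e (ltW dd).
  by apply: h4; rewrite e (ltW cc).
- right; split=> //; rewrite lt_neqAle ?cc ?dd andbT; apply/eqP => e.
    by apply: h4; rewrite e (ltW bb).
  by apply: h3; rewrite e (ltW aa).
Qed.

Lemma box_closed_set2 x y u v w : box_closed x y [set u; v] ->
  x u <= x w <= x v ->
  (y u <= y w <= y v) \/ (y v <= y w <= y u) -> w = u \/ w = v.
Proof.
move=> cl /andP[h1 h2] h; suff: w \in [set u; v] by case/set2P; [left|right].
have uS : u \in [set u; v] by rewrite set21.
have vS : v \in [set u; v] by rewrite set22.
apply: cl; [by exists u|by exists v| |].
  by case: h => /andP[h3 h4]; [exists u|exists v].
by case: h => /andP[h3 h4]; [exists v|exists u].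
Qed.

Lemma pierces_set2 x y u v u' v' :
  x u < x u' < x v -> x u < x v' < x v ->
  (y u' < y u < y v' /\ y u' < y v < y v') \/
  (y v' < y u < y u' /\ y v' < y v < y u') ->
  pierces x y [set u; v] [set u'; v'].
Proof.
move=> /andP[h1 h2] /andP[h3 h4] h; split.
- by exists u; rewrite ?set21 // => w /set2P[]->.
- by exists v; rewrite ?set22 // => w /set2P[]->.
- case: h => -[/andP[? ?] /andP[? ?]].
    by exists u'; rewrite ?set21 // => w /set2P[]->.
  by exists v'; rewrite ?set22 // => w /set2P[]->.
- case: h => -[/andP[? ?] /andP[? ?]].
    by exists v'; rewrite ?set22 // => w /set2P[]->.
  by exists u'; rewrite ?set21 // => w /set2P[]->.
Qed.

(** The common point is interior to both segments. A segment crosses itself in this sense, so a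
    crossing can only be shown to force equality. *)
Definition segments_cross x y u v u' v' : Prop :=
  exists s t, [/\ 0 < s < 1, 0 < t < 1,
    x u + s * (x v - x u) = x u' + t * (x v' - x u') &
    y u + s * (y v - y u) = y u' + t * (y v' - y u')].

Lemma segments_crossC x y u v u' v' :
  segments_cross x y u v u' v' -> segments_cross x y u' v' u v.
Proof. by case=> s [t [? ? ? ?]]; exists t, s; split. Qed.

Lemma segments_cross_rev x y u v u' v' :
  segments_cross x y u v u' v' -> segments_cross x y v u u' v'.
Proof.
case=> s [t [/andP[s0 s1] ? hx hy]]; exists (1 - s), t; split=> //.
- by apply/andP; split; lra.
- by rewrite -hx; ring.
- by rewrite -hy; ring.
Qed.

(** Put the origin at the crossing point and apply the two comparisons above to the offsets of the
    endpoints. Box-closedness supplies their hypotheses; nesting in [x] with reversed nesting in [y]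
    is a piercing. *)
Lemma cross_oriented x y u v u' v' : injective x ->
  box_closed x y [set u; v] -> box_closed x y [set u'; v'] ->
  ~ pierces x y [set u; v] [set u'; v'] ->
  ~ pierces x y [set u'; v'] [set u; v] ->
  x u < x v -> x u' < x v' -> y u < y v -> y u' != y v' ->
  segments_cross x y u v u' v' -> u = u' /\ v = v'.
Proof.
move=> xI cl cl' np np' xuv xuv' yuv yuv'.
move=> [s [t [/andP[s0 s1] /andP[t0 t1] ex ey]]].
have e1 := box_closed_set2 cl; have e2 := box_closed_set2 cl'.
set zx := x u + s * _ in ex; set zy := y u + s * _ in ey.
have S1 : 0 < 1 - s by lra.
have T1 : 0 < 1 - t by lra.
have A : zx - x u = s * (x v - x u) by rewrite /zx; ring.
have B : x v - zx = (1 - s) * (x v - x u) by rewrite /zx; ring.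
have C : zy - y u = s * (y v - y u) by rewrite /zy; ring.
have D : y v - zy = (1 - s) * (y v - y u) by rewrite /zy; ring.
have A' : zx - x u' = t * (x v' - x u') by rewrite ex; ring.
have B' : x v' - zx = (1 - t) * (x v' - x u') by rewrite ex; ring.
have C' : zy - y u' = t * (y v' - y u') by rewrite ey; ring.
have D' : y v' - zy = (1 - t) * (y v' - y u') by rewrite ey; ring.
have a0 : 0 < zx - x u by rewrite A mulr_gt0 ?subr_gt0.
have b0 : 0 < x v - zx by rewrite B mulr_gt0 ?subr_gt0.
have c0 : 0 < zy - y u by rewrite C mulr_gt0 ?subr_gt0.
have d0 : 0 < y v - zy by rewrite D mulr_gt0 ?subr_gt0.
have a'0 : 0 < zx - x u' by rewrite A' mulr_gt0 ?subr_gt0.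
have b'0 : 0 < x v' - zx by rewrite B' mulr_gt0 ?subr_gt0.
have ad : (zx - x u) * (y v - zy) = (x v - zx) * (zy - y u).
  by rewrite A B C D; ring.
have ad' : (zx - x u') * (y v' - zy) = (x v' - zx) * (zy - y u').
  by rewrite A' B' C' D'; ring.
have zy' : y u' < zy < y v' \/ y v' < zy < y u'.
  have [h|h|h] := ltgtP (y u') (y v'); [left|right|by rewrite h eqxx in yuv'].
    by rewrite -subr_gt0 C' -(subr_gt0 zy) D' !mulr_gt0 ?subr_gt0.
  by rewrite -subr_lt0 D' -(subr_lt0 _ zy) C' !pmulr_rlt0 // !subr_lt0 h.
(* The crossing point becomes opaque; the order facts and the two proportions suffice from here. *)
clear A B C D A' B' C' D' ex ey.
move: zx zy a0 b0 c0 d0 a'0 b'0 ad ad' zy'.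
move=> zx zy a0 b0 c0 d0 a'0 b'0 ad ad' zy'.
case: zy' => yu'.
- have c'0 : 0 < zy - y u' by case/andP: yu'; lra.
  have d'0 : 0 < y v' - zy by case/andP: yu'; lra.
  have [||||[h1 h2 _ _]|[h1 h2 h3 h4]|[h1 h2 h3 h4]] :=
    ascending_segments a0 b0 c0 d0 a'0 b'0 c'0 d'0 ad ad'.
  + move=> h1 h2; have [| |->|e] := e2 u; [|left| |]; try lra.
    by rewrite e in a0; lra.
  + move=> h1 h2; have [| |->|e] := e1 u'; [|left| |]; try lra.
    by rewrite e in a'0; lra.
  + move=> h1 h2; have [| |e|->] := e2 v; [|left| |]; try lra.
    by rewrite e in b0; lra.
  + move=> h1 h2; have [| |e|->] := e1 v'; [|left| |]; try lra.
    by rewrite e in b'0; lra.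
  + by split; apply: xI; lra.
  + case: np'; apply: pierces_set2; [| |left]; lra.
  + case: np; apply: pierces_set2; [| |left]; lra.
(* The second segment descends, so its lower endpoint is [v']. Coincidence is impossible and both
   outcomes are piercings. *)
- have c'0 : 0 < zy - y v' by case/andP: yu'; lra.
  have d'0 : 0 < y u' - zy by case/andP: yu'; lra.
  exfalso; have [||||[h1 h2 h3 h4]|[h1 h2 h3 h4]] :=
    @opposite_segments (zx - x u) (x v - zx) (zy - y u) (y v - zy)
      (zx - x u') (x v' - zx) (zy - y v') (y u' - zy).
  + move=> [h1 h2]; have [| |e|e] := e2 u; [|right| |];
      try lra; [rewrite e in c0|rewrite e in a0]; lra.
  + move=> [h1 h2]; have [| |e|e] := e2 v; [|right| |];
      try lra; [rewrite e in b0|rewrite e in d0]; lra.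
  + move=> [h1 h2]; have [| |e|e] := e1 u'; [|left| |];
      try lra; [rewrite e in d'0|rewrite e in a'0]; lra.
  + move=> [h1 h2]; have [| |e|e] := e1 v'; [|left| |];
      try lra; [rewrite e in b'0|rewrite e in c'0]; lra.
  + case: np'; apply: pierces_set2; [| |left]; lra.
  + case: np; apply: pierces_set2; [| |right]; lra.
Qed.

Lemma nonpiercing_family_opp x y F : nonpiercing_family x y F ->
  nonpiercing_family x (fun w => - y w) F.
Proof.
move=> [cl np]; split=> [S SF w hl hr [b bS hb] [t tS ht]|
    S T SF TF [hl hr [b bT hb] [t tT ht]]].
  by apply: (cl _ SF); [| |exists t|exists b] => //; rewrite -lerN2.
apply: (np _ _ SF TF); split=> //.
  by exists t => // w /ht; rewrite ltrN2.
by exists b => // w /hb; rewrite ltrN2.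
Qed.

Lemma segments_cross_opp x y u v u' v' : segments_cross x y u v u' v' ->
  segments_cross x (fun w => - y w) u v u' v'.
Proof.
case=> s [t [s01 t01 hx hy]]; exists s, t; split=> //.
by move: hy => /(congr1 -%R); rewrite !opprD -!mulrN !opprD.
Qed.

Lemma pair_graph_sym F : symmetric (pair_graph F).
Proof. by move=> p q; rewrite /pair_graph eq_sym finset.setUC. Qed.

(** Reversing segments, exchanging them and reflecting [y] reduce every crossing to one whose first
    segment ascends. *)
Lemma pair_graph_no_cross x y F u v u' v' : injective x -> injective y ->
  nonpiercing_family x y F -> pair_graph F u v -> pair_graph F u' v' ->
  segments_cross x y u v u' v' -> [set u; v] = [set u'; v'].
Proof.
move=> xI yI npF; wlog xuv : u v / x u < x v => [hw|].
  have [h|h|/xI ->] := ltgtP (x u) (x v); first exact: hw.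
  - rewrite (finset.setUC [set u]) pair_graph_sym => e e' /segments_cross_rev.
    exact: hw.
  - by rewrite /pair_graph eqxx.
wlog xuv' : u' v' / x u' < x v' => [hw|].
  have [h|h|/xI ->] := ltgtP (x u') (x v'); first exact: hw.
  - rewrite (finset.setUC [set u']) (pair_graph_sym _ u') => e e'.
    move=> /segments_crossC/segments_cross_rev/segments_crossC; exact: hw.
  - by rewrite {2}/pair_graph eqxx.
move=> /andP[uv uvF] /andP[uv' uvF'] cr.
have ne' : y u' != y v' by apply: contraNneq uv' => /yI ->.
have ne : y u != y v by apply: contraNneq uv => /yI ->.
have [cl np] := npF.
have [yuv|yuv|e] := ltgtP (y u) (y v); last by rewrite e eqxx in ne.
  have [||||-> -> //] := cross_oriented xI _ _ _ _ xuv xuv' yuv ne' cr;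
    by [exact: cl|exact: np].
have [yuv'|yuv'|e] := ltgtP (y u') (y v'); last by rewrite e eqxx in ne'.
  have [||||-> -> //] :=
    cross_oriented xI _ _ _ _ xuv' xuv yuv' ne (segments_crossC cr);
    by [exact: cl|exact: np].
have [cl' np'] := nonpiercing_family_opp npF.
have [||||||-> -> //] :=
  cross_oriented xI _ _ _ _ xuv xuv' _ _ (segments_cross_opp cr).
- exact: cl'.
- exact: cl'.
- exact: np'.
- exact: np'.
- by rewrite ltrN2.
- by rewrite eqr_opp.
Qed.

End Boxes.

(** * Planarity of the straight-line drawing *)

Lemma continuous_segment (R : realType) (a b : R) (A : set R) :
  {within A, continuous (fun t : R => a + t * (b - a))}%classic.
Proof.
apply: continuous_subspaceT => t.
by apply: cvgD; [exact: cvg_cst|apply: cvgM; [exact: cvg_id|exact: cvg_cst]].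
Qed.

(** A vertex on an edge lies in the box of a two-point member, so it is an endpoint; edges that
    cross are equal. *)
Lemma pair_graph_planar (R : realType) (J : finType) (x y : J -> R)
    (F : {set {set J}}) : injective x -> injective y ->
  nonpiercing_family x y F -> planar R (pair_graph F).
Proof.
move=> xI yI npF; have [cl np] := npF.
exists (fun p => (x p, y p)), (fun u v t => x u + t * (x v - x u)),
  (fun u v t => y u + t * (y v - y u)).
(* The endpoints differ in [x], so this coordinate alone determines the parameter. *)
have inj (u v : J) (s t : R) : u != v ->
    x u + s * (x v - x u) = x u + t * (x v - x u) -> s = t.
  move=> uv /addrI/mulIf; apply.
  by rewrite subr_eq0 eq_sym; apply: contraNneq uv => /xI ->.
split; first by move=> p q [/xI].
split.
  move=> u v uv _; split.
  - exact: continuous_segment.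
  - exact: continuous_segment.
  - by rewrite !mul0r !addr0.
  - by rewrite !mul1r (addrC (x u)) (addrC (y u)) !subrK.
  - by move=> s t _ _ [/(inj _ _ _ _ uv)].
split.
  move=> u v w t uv /andP[_ uvF] /andP[t0 t1] [ex ey].
  have mid (f : J -> R) : f u + t * (f v - f u) = f w ->
      (exists2 l, l \in [set u; v] & f l <= f w) /\
      (exists2 r, r \in [set u; v] & f w <= f r).
    move=> <-; have T1 : 0 <= 1 - t by lra.
    have [h|h] := leP (f u) (f v).
    - have h1 : 0 <= t * (f v - f u) by apply: mulr_ge0; lra.
      have h2 : 0 <= (1 - t) * (f v - f u) by apply: mulr_ge0; lra.
      split; [exists u|exists v]; rewrite ?set21 ?set22 //; lra.
    - have h1 : 0 <= t * (f u - f v) by apply: mulr_ge0; lra.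
      have h2 : 0 <= (1 - t) * (f u - f v) by apply: mulr_ge0; lra.
      split; [exists v|exists u]; rewrite ?set21 ?set22 //; lra.
  have [xl xr] := mid _ ex; have [yb yt] := mid _ ey.
  have /set2P[e|e] := cl _ uvF w xl xr yb yt; subst w.
  - have e0 : t = 0 by apply: (inj u v) => //; rewrite ex mul0r addr0.
    by rewrite e0 ltxx in t0.
  - have e0 : t = 1 by apply: (inj u v) => //; rewrite ex mul1r addrC subrK.
    by rewrite e0 ltxx in t1.
move=> u v u' v' s t uv e uv' e' ne s01 t01 [ex ey]; apply: ne.
have E : [set u; v] = [set u'; v'].
  by apply: (pair_graph_no_cross xI yI npF e e'); exists s, t.
have /set2P hu : u \in [set u'; v'] by rewrite -E set21.
have /set2P hv : v \in [set u'; v'] by rewrite -E set22.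
case: hu hv uv => -> [] ->; rewrite ?eqxx ?orbT //.
Qed.

(** * From colour classes of rectangles to nonpiercing families *)

Theorem theorem4 (R : realType) (I J : finType) (rs : I -> rect R)
    (ps : J -> R * R) (k : nat) :
  (forall i, wf_rect (rs i)) ->
  general_position rs ps ->
  chromatic_number (piercing_edge rs) k ->
  exists G : 'I_k -> rel J,
    (forall i, symmetric (G i) /\ planar R (G i)) /\
    is_support rs ps (union_graph G).
Proof.
move=> wf [gp _] [[c pc] _].
pose x p := (ps p).1; pose y p := (ps p).2.
have xI : injective x.
  move=> p q e; apply/eqP; have [//|/gp[h _]] := eqVneq p q.
  by rewrite -/(x p) e eqxx in h.
have yI : injective y.
  move=> p q e; apply/eqP; have [//|/gp[_ h]] := eqVneq p q.
  by rewrite -/(y p) e eqxx in h.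
pose pts i := [set p | in_rect (rs i) (ps p)].
(* Within a colour class, a piercing pair of traces would come from a piercing pair of
   rectangles. *)
have npF0 a : nonpiercing_family x y [set pts i | i in [pred i | c i == a]].
  split.
  - move=> _ /imsetP[i _ ->] w [l lS hl] [r rS hr] [b bS hb] [t tS ht].
    move: lS rS bS tS; rewrite !inE /in_rect -/(x w) -/(y w).
    move=> /andP[/andP[l1 _] _] /andP[/andP[_ r1] _].
    move=> /andP[_ /andP[b1 _]] /andP[_ /andP[_ t1]].
    by rewrite (le_trans l1 hl) (le_trans hr r1) (le_trans b1 hb)
       (le_trans ht t1).
  - move=> _ _ /imsetP[i ci ->] /imsetP[j cj ->].
    move=> [[l lS hl] [r rS hr] [b bS hb] [t tS ht]].
    have {}ci : c i = a := eqP ci; have {}cj : c j = a := eqP cj.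
    have mem i0 p : p \in pts i0 <-> [/\ rx1 (rs i0) <= x p, x p <= rx2 (rs i0),
        ry1 (rs i0) <= y p & y p <= ry2 (rs i0)].
      rewrite inE /in_rect; split=> [|[h1 h2 h3 h4]].
        by case/andP=> /andP[h1 h2] /andP[h3 h4]; split.
      by apply/andP; split; apply/andP; split.
    have [l1 l2 l3 l4] := (mem _ _).1 lS; have [r1 r2 r3 r4] := (mem _ _).1 rS.
    have [b1 b2 b3 b4] := (mem _ _).1 bS; have [t1 t2 t3 t4] := (mem _ _).1 tS.
    (* Vertically, [l] lies between [b] and [t], hence within rectangle [j]. Not being to the left
       of it would put [l] into the trace of [j], which is strictly to its right. The other three
       sides are analogous. *)
    have lj : x l < rx1 (rs j).
      rewrite ltNge; apply/negP => h.
      have /hl : l \in pts j.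
        apply/mem; split=> //; have := hl _ bS; have := hb _ lS;
        have := ht _ lS; lra.
      by rewrite ltxx.
    have rj : rx2 (rs j) < x r.
      rewrite ltNge; apply/negP => h.
      have /hr : r \in pts j.
        apply/mem; split=> //; have := hr _ bS; have := hb _ rS;
        have := ht _ rS; lra.
      by rewrite ltxx.
    have bi : y b < ry1 (rs i).
      rewrite ltNge; apply/negP => h.
      have /hb : b \in pts i.
        apply/mem; split=> //; have := hl _ bS; have := hr _ bS;
        have := hb _ lS; lra.
      by rewrite ltxx.
    have ti : ry2 (rs i) < y t.
      rewrite ltNge; apply/negP => h.
      have /ht : t \in pts i.
        apply/mem; split=> //; have := hl _ tS; have := hr _ tS;
        have := ht _ lS; lra.
      by rewrite ltxx.
    suff /pc : piercing_edge rs i j by rewrite ci cj eqxx.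
    have [wi1 wi2] := wf i; have [wj1 wj2] := wf j.
    (* Rectangle [i] is strictly wider and [j] strictly taller, so the corners of [j] miss [i] in
       [y] and those of [i] miss [j] in [x]. *)
    have x1 : (rx1 (rs i) < rx1 (rs j)) by lra.
    have x2 : (rx2 (rs j) < rx2 (rs i)) by lra.
    have y1 : (ry1 (rs j) < ry1 (rs i)) by lra.
    have y2 : (ry2 (rs i) < ry2 (rs j)) by lra.
    rewrite /piercing_edge; apply/and4P; split.
    + by apply: contraTneq x1 => ->; rewrite ltxx.
    + by apply/and4P; split; lra.
    + rewrite /contains_corner_of /= /in_rect /=.
      by rewrite !(leNgt (ry1 (rs i))) !(leNgt _ (ry2 (rs i))) y1 y2 /= !andbF.
    + rewrite /contains_corner_of /= /in_rect /=.
      by rewrite !(leNgt (rx1 (rs j))) !(leNgt _ (rx2 (rs j))) x1 x2 /= !andbF.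
have /choice[Fm FmP] : forall a, exists F : {set {set J}},
    maximal_nonpiercing x y F /\ (forall i, c i = a -> pts i \in F).
  move=> a; have [F mF sF] := maximal_nonpiercing_exists (npF0 a).
  exists F; split=> // i ci; apply: (fintype.subsetP sF); apply: imset_f.
  by rewrite inE ci.
exists (fun a => pair_graph (Fm a)); split.
  move=> a; split; first exact: pair_graph_sym.
  exact: pair_graph_planar xI yI (FmP a).1.1.
(* The graph of the colour of [i] alone connects the points of rectangle [i]. *)
move=> i u v uS vS; have [mF /(_ i erefl) iF] := FmP (c i).
have : connect (fun p q => [&& p \in pts i, q \in pts i
    & pair_graph (Fm (c i)) p q]) u v.
  by apply: (pair_graph_connected xI yI mF iF); rewrite inE.
apply: connect_sub => p q; rewrite !inE => /and3P[pS qS e]; apply: connect1.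
by rewrite pS qS; apply/existsP; exists (c i).
Qed.
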